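(* Let $V\subset\mathbb{C}^4$ be a generic complex affine plane, $V^\times=V\cap(\mathbb{C}^\times)^4$, let $\mathcal{C}:V^\times\to(S^1)^4$ be its coamoeba map, $Z\subset V^\times$ the set of critical points of $\mathcal{C}$, and $\mathcal{C}_Z=\mathcal{C}(Z)$ the set of critical values. Then the projection $\mathcal{C}|_Z:Z\to\mathcal{C}_Z$ is a locally trivial fiber bundle whose fibers are open intervals.
   Context: Notation: $\mathbb{C}^\times=\mathbb{C}\setminus\{0\}$. A complex affine plane in $\mathbb{C}^4$ is a complex affine subspace of complex dimension 2. ''Generic'' means: outside a proper real-algebraic subset of the space of all complex affine planes in $\mathbb{C}^4$. The map $Arg:(\mathbb{C}^\times)^4\to(S^1)^4$ is defined coordinatewise by $z\mapsto z/|z|$, and the coamoeba map $\mathcal{C}$ is its restriction to $V^\times$. It is a smooth map between real 4-dimensional manifolds; its critical points are the points where its real differential is not surjective. $Z$ and $\mathcal{C}_Z$ carry the subspace topologies. *)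

(* Defs.v *)
From HB Require Import structures.
From mathcomp Require Import all_boot all_order all_algebra.
From mathcomp Require Import all_classical all_reals all_analysis.
From mathcomp Require Import complex.
From mathcomp Require Import -(notations) mpoly.

Set Implicit Arguments.
Unset Strict Implicit.
Unset Printing Implicit Defensive.

Import Order.TTheory GRing.Theory Num.Theory.
Import numFieldNormedType.Exports.

Local Open Scope classical_set_scope.
Local Open Scope ring_scope.

(* The usual topology on C and, entrywise, on matrices over C. *)
HB.instance Definition _ (R : realType) := NormedModule.copy R[i] R[i]^o.

Section FiberBundles.

Definition homeomorphism (X Y : topologicalType) (f : X -> Y) : Prop :=
  continuous f /\
  exists g : Y -> X, [/\ cancel f g, cancel g f & continuous g].

(* Sets coerce to the subtypes of their elements, with the subspace topology. *)
Definition locally_trivial_bundle (E B F : topologicalType) (p : E -> B) :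
    Prop :=
  continuous p /\
  forall b : B, exists U : set B, [/\ open U, U b &
    exists phi : (p @^-1` U : set E) -> ((U : set B) * F)%type,
      homeomorphism phi /\
      forall e : (p @^-1` U : set E), set_val (phi e).1 = p (set_val e)].

(* f as a map from A onto its image f(A). *)
Definition restr (X Y : topologicalType) (f : X -> Y) (A : set X) (x : A) :
    (f @` A : set Y) :=
  SigSub (mem_set (imageP f (set_valP x))).

End FiberBundles.

Section AffinePlanes.
Variable R : realType.
Local Notation C := R[i].

Definition affine_plane (a : 'rV[C]_4) (B : 'M[C]_(2, 4)) : set 'rV[C]_4 :=
  [set a + c *m B | c in [set: 'rV[C]_2]].

Definition is_affine_plane (V : set 'rV[C]_4) : Prop :=
  exists a B, \rank B = 2%N /\ V = affine_plane a B.

Definition real_coords m n (A : 'M[C]_(m, n)) : 'rV[R]_(m * (n + n)) :=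
  mxvec (row_mx (map_mx (@complex.Re R) A) (map_mx (@complex.Im R) A)).

(* The space of affine planes is the quotient of the open set of pairs (a, B)
   with B of rank 2 by the action of the affine group of C^2. That projection
   has local algebraic sections, so a set of planes is real-algebraic iff its
   preimage is cut out by real polynomials in the real and imaginary parts of
   the entries of a and B. *)
Definition real_algebraic (E : set (set 'rV[C]_4)) : Prop :=
  exists ps : seq (mpoly ((1 + 2) * (4 + 4)) R),
    forall a B, \rank B = 2%N ->
      (E (affine_plane a B) <->
       forall p, p \in ps ->
         meval (fun k => real_coords (col_mx a B) 0 k) p = 0).

Definition generic_plane (P : set 'rV[C]_4 -> Prop) : Prop :=
  exists E : set (set 'rV[C]_4),
    [/\ real_algebraic E,
        exists2 V, is_affine_plane V & ~ E V &
        forall V, is_affine_plane V -> ~ E V -> P V].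

End AffinePlanes.

Section Coamoeba.
Variable R : realType.
Local Notation C := R[i].

Definition Arg (z : 'rV[C]_4) : 'rV[C]_4 := \row_i (z 0 i / `|z 0 i|).

Definition in_torus (V : set 'rV[C]_4) : set 'rV[C]_4 :=
  V `&` [set z | forall i, z 0 i != 0].

Definition realify (z : 'rV[C]_4) : 'rV[R]_(4 + 4) :=
  row_mx (map_mx (@complex.Re R) z) (map_mx (@complex.Im R) z).

Definition complexify (x : 'rV[R]_(4 + 4)) : 'rV[C]_4 :=
  \row_i (lsubmx x 0 i +i* rsubmx x 0 i)%C.

Definition real_diff (f : 'rV[C]_4 -> 'rV[C]_4) (z v : 'rV[C]_4) :
    'rV[C]_4 :=
  complexify ('d (realify \o f \o complexify) (realify z) (realify v)).

(* V^\times is open in the plane V, so for z in V its tangent space at z is the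
   direction of V. *)
Definition tangent_plane (V : set 'rV[C]_4) (z : 'rV[C]_4) : set 'rV[C]_4 :=
  [set x - z | x in V].

(* The real tangent space at t of (S^1)^4, viewed inside C^4. *)
Definition tangent_torus (t : 'rV[C]_4) : set 'rV[C]_4 :=
  [set w | forall i, complex.Re (w 0 i * (t 0 i)^*) = 0].

(* Arg is smooth on the open set (C^\times)^4, hence the differential at z of
   its restriction to V^\times is the restriction of its differential to the
   tangent space of V. *)
Definition critical_points (V : set 'rV[C]_4) : set 'rV[C]_4 :=
  [set z | in_torus V z /\
     ~ (tangent_torus (Arg z) `<=` real_diff Arg z @` tangent_plane V z)].

End Coamoeba.

(* Main.v *)
From HB Require Import structures.
Require Import Defs.
From mathcomp Require Import all_boot all_order all_algebra.
From mathcomp Require Import all_classical all_reals all_analysis.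
From mathcomp Require Import complex.
From mathcomp Require Import -(notations) mpoly.
From mathcomp Require Import ring.
Import Order.TTheory GRing.Theory Num.Theory.
Import numFieldNormedType.Exports.
Set Implicit Arguments.
Unset Strict Implicit.
Unset Printing Implicit Defensive.
Local Open Scope classical_set_scope.
Local Open Scope ring_scope.

(** The fibre of the coamoeba map through z consists of the points of the plane
    V whose i-th coordinate is a positive multiple of theta_i = z_i / |z_i|.
    Write V as the points a + v, v in the complex span of the rows of a 2 x 4
    matrix B, and parametrize v by x in R^4.  Then the fibre over theta is the
    set of solutions of the real affine system
      Im ((a + v(x))_i conj theta_i) = 0,   0 <= i <= 3,
    that satisfy Re ((a + v(x))_i conj theta_i) > 0.

    The differential of Arg at z sends v to the vector with coordinates
    i theta_i Im (v_i conj theta_i) / |z_i| ([real_diff_Arg]), so z is critical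
    exactly when the 4 x 4 matrix of this system is singular ([criticalP]).
    That condition depends only on theta: every point of a fibre over a
    critical value is critical, and such a fibre is the intersection of an
    affine space with an open orthant.

    For a generic plane the kernel of the system is at most a line.  Indeed two
    complex-independent vectors of the kernel would be a basis of the direction
    of V that becomes real after dividing the i-th coordinate by theta_i, and
    this makes the cross-ratio p01 p23 / (p02 p13) of the Pluecker coordinates
    real; vectors that are complex-dependent are real-dependent
    ([kernel_line]).  The cross-ratio is real or undefined exactly when
    Im (p01 p23 conj (p02 p13)) = 0, a real polynomial equation on planes.  So outside that algebraic set
    the fibres over critical values are nonempty open segments or open rays.

    For local triviality, fix a critical value theta0, a point x0 over it and a
    kernel vector k0 there.  Imposing x . k0 = x0 . k0 makes the solution of the
    system unique, and its normal equations have an invertible matrix at theta0,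
    hence near it; so Cramer's rule gives a base point and a kernel vector that
    are continuous in theta ([solutionP], [kernel_vectorP]).  The fibre is then
    a set of t with offset_i + t slope_i > 0 for all i and offset_i > 0, an
    interval ]- 1/lo, 1/hi[ where lo and hi are maxima of continuous functions,
    with the convention 1/0 = infinity.  Segments and rays are treated at once:
    t |-> (1 + t lo) / ((1 + t lo) + (1 - t hi)) maps the interval onto ]0, 1[,
    is continuous in (lo, hi, t), and has a continuous inverse
    ([line_positive], [to_unitK], [of_unit_bounds]). *)

(** * Local triviality of restrictions to subspaces *)

Lemma continuous_to_set (X Y : topologicalType) (A : set Y) (f : X -> A) (x : X) :
  {for x, continuous (set_val \o f)} -> {for x, continuous f}.
Proof.
move=> fc W [V [[V0 oV0 <-] V0fx sVW]].
have V0n : nbhs x ((set_val \o f) @^-1` V0).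
  exact: fc (open_nbhs_nbhs (conj oV0 V0fx)).
by apply: (filterS _ V0n) => y V0y; apply: sVW.
Qed.

Lemma continuous_from_set (X Y : topologicalType) (A : set X) (f : X -> Y) (x : A) :
  {for set_val x, continuous f} -> {for x, continuous (f \o set_val)}.
Proof. by move=> fc; apply: continuous_comp => //; apply: initial_continuous. Qed.

Lemma open_preim_set_val (X : topologicalType) (A : set X) (W : set X) :
  open W -> open (set_val @^-1` W : set A).
Proof. by move=> oW; exists W. Qed.

Lemma set_valK (X : Type) (A : set X) (x y : A) : set_val x = set_val y -> x = y.
Proof. exact: val_inj. Qed.

(** Rephrases local triviality in the ambient spaces, which spares the bundle
    charts from mentioning nested subtypes: the trivialization over W is
    x |-> (f x, h x), and its inverse is g. *)
Lemma locally_trivial_restr (X Y : topologicalType) (f : X -> Y) (Z : set X)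
    (F : topologicalType) (D : set F) :
  (forall x, Z x -> {for x, continuous f}) ->
  (forall y0, (f @` Z) y0 -> exists (W : set Y) (h : X -> F) (g : Y * F -> X),
    [/\ nbhs y0 W,
        forall x, Z x -> W (f x) ->
          [/\ D (h x), g (f x, h x) = x & {for x, continuous h}] &
        forall y u, (f @` Z) y -> W y -> D u ->
          [/\ Z (g (y, u)), f (g (y, u)) = y, h (g (y, u)) = u &
              {for (y, u), continuous g}]]) ->
  locally_trivial_bundle D (restr f (A := Z)).
Proof.
move=> fc loc.
have rc : continuous (restr f (A := Z)).
  move=> x; apply: continuous_to_set.
  have -> : set_val \o restr f (A := Z) = f \o set_val by [].
  by apply: continuous_from_set; apply: fc; apply: set_valP.
split=> // y0.
have [W [h [g [Wy0 hP gP]]]] := loc _ (set_valP y0).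
pose U : set (f @` Z) := set_val @^-1` W°.
have UW y : U y -> W (set_val y) by move=> Uy; exact: interior_subset.
exists U; split.
- by apply: open_preim_set_val; apply: open_interior.
- exact: Wy0.
have Zx (e : (restr f (A := Z)) @^-1` U) : Z (set_val (set_val e)).
  exact: set_valP.
have Wx (e : (restr f (A := Z)) @^-1` U) : W (f (set_val (set_val e))).
  exact: (UW (restr f (set_val e)) (set_valP e)).
have hD (e : (restr f (A := Z)) @^-1` U) : D (h (set_val (set_val e))).
  by have [] := hP _ (Zx e) (Wx e).
pose phi (e : (restr f (A := Z)) @^-1` U) : (U * D)%type :=
  (SigSub (mem_set (set_valP e : U (restr f (set_val e)))),
   SigSub (mem_set (hD e))).
have gQ (q : (U * D)%type) :=
  gP (set_val (set_val q.1)) (set_val q.2) (set_valP _)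
     (UW _ (set_valP q.1)) (set_valP q.2).
have gZ (q : (U * D)%type) : Z (g (set_val (set_val q.1), set_val q.2)).
  by have [] := gQ q.
pose gz q : Z := SigSub (mem_set (gZ q)).
have gU q : U (restr f (gz q)).
  rewrite (_ : restr f (gz q) = set_val q.1); first exact: set_valP.
  by apply: set_valK; have [] := gQ q.
pose psi q : (restr f (A := Z)) @^-1` U :=
  SigSub (mem_set (gU q : ((restr f (A := Z)) @^-1` U) (gz q))).
have phi1 : continuous (fun e => (phi e).1).
  move=> e; apply: continuous_to_set.
  have -> : set_val \o (fun e => (phi e).1) = restr f (A := Z) \o set_val by [].
  by apply: continuous_from_set; apply: rc.
have phi2 : continuous (fun e => (phi e).2).
  move=> e; apply: continuous_to_set.
  have -> : set_val \o (fun e => (phi e).2) = (h \o set_val) \o set_val by [].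
  apply: continuous_from_set; apply: continuous_from_set.
  by have [] := hP _ (Zx e) (Wx e).
have psic : continuous psi.
  move=> q; apply: continuous_to_set; apply: continuous_to_set.
  have -> : set_val \o (set_val \o psi) =
    g \o (fun q => (set_val (set_val q.1), set_val q.2)) by [].
  apply: continuous_comp; last by have [] := gQ q.
  apply: cvg_pair => /=.
    apply: (@continuous_comp _ _ _ (set_val \o fst) set_val).
      apply: (@continuous_comp _ _ _ fst set_val); first exact: cvg_fst.
      exact: initial_continuous.
    exact: initial_continuous.
  apply: (@continuous_comp _ _ _ snd set_val); first exact: cvg_snd.
  exact: initial_continuous.
exists phi; split=> //; split.
  by move=> e; exact: (cvg_pair (phi1 e) (phi2 e)).
exists psi; split=> //.
- move=> e; apply: set_valK; apply: set_valK.
  by have [_ + _] := hP _ (Zx e) (Wx e).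
- move=> q; have [_ fg hg _] := gQ q.
  by rewrite [RHS]surjective_pairing; congr pair;
     [apply: set_valK; apply: set_valK|apply: set_valK].
Qed.

(** * Open intervals and rays in a uniform coordinate *)

Section Rays.
Variable R : realType.
Implicit Types (lo hi t u : R).

(** When all al i are positive, the largest t >= 0 for which al i - t * be i
    stays nonnegative for all i is the inverse of [steepness al be].  Working
    with the inverse makes an unbounded ray correspond to the finite value 0,
    and keeps the bound continuous. *)
Definition steepness n (al be : 'I_n -> R) : R := \big[Num.max/0]_i (be i / al i).

Lemma steepness_ge0 n (al be : 'I_n -> R) : 0 <= steepness al be.
Proof. exact: bigmax_ge_id. Qed.

Lemma ray_positive n (al be : 'I_n -> R) t : (forall i, 0 < al i) -> 0 <= t ->
  (forall i, 0 < al i - t * be i) <-> 0 < 1 - t * steepness al be.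
Proof.
move=> al0; rewrite le_eqVlt => /orP[/eqP <-|t0].
  by split=> [_|_ i]; rewrite mul0r subr0.
rewrite subr_gt0 mulrC -ltr_pdivlMr// mul1r.
split=> [pos|lt i].
  apply: bigmax_lt; first by rewrite invr_gt0.
  move=> i _; rewrite ltr_pdivrMr// mulrC ltr_pdivlMr// mulrC -subr_gt0.
  exact: pos.
have : be i / al i < t^-1 by apply: le_lt_trans lt; exact: le_bigmax.
by rewrite ltr_pdivrMr// mulrC ltr_pdivlMr// mulrC -subr_gt0.
Qed.

(** For t >= 0 only the bound on the right can fail, for t <= 0 only the bound
    on the left. *)
Lemma line_positive n (al be : 'I_n -> R) t : (forall i, 0 < al i) ->
  (forall i, 0 < al i + t * be i) <->
  0 < 1 + t * steepness al be /\
  0 < 1 - t * steepness al (fun i => - be i).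
Proof.
move=> al0; have lo0 := steepness_ge0 al be.
have hi0 := steepness_ge0 al (fun i => - be i).
have [t0|/ltW t0] := leP 0 t.
  rewrite -(ray_positive _ al0 t0); split=> [pos|[_ pos] i].
    split=> [|i]; last by rewrite mulrN opprK.
    by rewrite ltr_pwDl// mulr_ge0.
  by have := pos i; rewrite mulrN opprK.
have nt0 : 0 <= - t by rewrite oppr_ge0.
rewrite -[in 1 + _](opprK t) mulNr -(ray_positive be al0 nt0).
split=> [pos|[pos _] i].
  split=> [i|]; first by rewrite mulNr opprK.
  by rewrite -mulNr ltr_pwDl// mulr_ge0.
by have := pos i; rewrite mulNr opprK.
Qed.

(** The two bounds are not both infinite: a nonconstant coordinate vanishes
    somewhere on the line. *)
Lemma steepness_gt0 n (al be : 'I_n -> R) : (forall i, 0 < al i) ->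
  (exists i, be i != 0) ->
  0 < steepness al be + steepness al (fun i => - be i).
Proof.
move=> al0 [i bei].
have lo : be i / al i <= steepness al be by exact: le_bigmax.
have hi : - be i / al i <= steepness al (fun i => - be i).
  exact: (@le_bigmax _ _ _ _ (fun i => - be i / al i)).
have lo0 := steepness_ge0 al be.
have hi0 := steepness_ge0 al (fun i => - be i).
have [b0|b0|b0] := ltgtP (be i) 0; last by rewrite b0 eqxx in bei.
  by apply: ltr_wpDl => //; apply: lt_le_trans hi; rewrite divr_gt0// oppr_gt0.
by apply: ltr_wpDr => //; apply: lt_le_trans lo; rewrite divr_gt0.
Qed.

(** A homography in t sending - 1/lo to 0 and 1/hi to 1.  Its determinant is
    lo + hi, so it maps the interval increasingly onto ]0, 1[ as soon as lo or
    hi is positive, including when one of the two endpoints is at infinity. *)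
Definition to_unit lo hi t : R := (1 + t * lo) / ((1 + t * lo) + (1 - t * hi)).
Definition of_unit lo hi u : R := (2 * u - 1) / (lo * (1 - u) + hi * u).

Lemma to_unit_itv lo hi t : 0 < 1 + t * lo -> 0 < 1 - t * hi ->
  0 < to_unit lo hi t < 1.
Proof.
move=> l h; have D := addr_gt0 l h; apply/andP; split; first exact: divr_gt0.
by rewrite ltr_pdivrMr// mul1r ltrDl.
Qed.

Lemma of_unit_den lo hi u : 0 <= lo -> 0 <= hi -> 0 < lo + hi -> 0 < u < 1 ->
  0 < lo * (1 - u) + hi * u.
Proof.
move=> l h lh /andP[u0 u1]; have [lo0|] := eqVneq lo 0.
  by rewrite lo0 mul0r add0r mulr_gt0//; rewrite lo0 add0r in lh.
by move=> ln; rewrite ltr_pwDl ?mulr_gt0 ?mulr_ge0 ?subr_gt0// ?ltW// lt_def ln.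
Qed.

Lemma to_unitK lo hi t : 0 <= lo -> 0 <= hi -> 0 < lo + hi ->
  0 < 1 + t * lo -> 0 < 1 - t * hi -> of_unit lo hi (to_unit lo hi t) = t.
Proof.
move=> l h lh tl th.
have D := of_unit_den l h lh (to_unit_itv tl th).
apply: (mulIf (lt0r_neq0 D)); rewrite divfK ?lt0r_neq0//.
rewrite /to_unit; field; exact: lt0r_neq0 (addr_gt0 tl th).
Qed.

Lemma of_unit_bounds lo hi u (t := of_unit lo hi u) :
    0 <= lo -> 0 <= hi -> 0 < lo + hi -> 0 < u < 1 ->
  [/\ 0 < 1 + t * lo, 0 < 1 - t * hi & to_unit lo hi t = u].
Proof.
move=> l h lh u01; have D := of_unit_den l h lh u01.
have Dn := lt0r_neq0 D; case/andP: u01 => u0 u1.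
have e1 : 1 + t * lo = u * (lo + hi) / (lo * (1 - u) + hi * u).
  by rewrite /t /of_unit; field.
have e2 : 1 - t * hi = (1 - u) * (lo + hi) / (lo * (1 - u) + hi * u).
  by rewrite /t /of_unit; field.
split; rewrite /to_unit ?e1 ?e2 ?divr_gt0 ?mulr_gt0 ?subr_gt0//.
rewrite -!mulrDl (addrC u) subrK mul1r.
by field; rewrite Dn lt0r_neq0.
Qed.

End Rays.

(** * Continuity of matrix and complex expressions *)

Section Continuity.
Variables (T : topologicalType) (x : T).

Lemma continuous_mx (K : numFieldType) m n (F : T -> 'M[K]_(m, n)) :
  (forall i j, {for x, continuous (fun y => F y i j)}) -> {for x, continuous F}.
Proof.
move=> Fc A [P PF PA].
have near_entry : nbhs x [set y | forall ij : 'I_m * 'I_n, P ij.1 ij.2 (F y ij.1 ij.2)].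
  by apply: filter_forall => -[i j] /=; apply: Fc; apply: PF.
apply: (filterS _ near_entry) => y Py; apply: PA => i j; exact: (Py (i, j)).
Qed.

Lemma continuous_entry (K : numFieldType) m n (F : T -> 'M[K]_(m, n)) i j :
  {for x, continuous F} -> {for x, continuous (fun y => F y i j)}.
Proof. by move=> Fc; exact: (continuous_comp Fc (@coord_continuous K m n i j _)). Qed.

Lemma continuous_sum (K : numFieldType) I (r : seq I) (f : I -> T -> K) :
  (forall i, {for x, continuous (f i)}) ->
  {for x, continuous (fun y => \sum_(i <- r) f i y)}.
Proof. by move=> fc; apply: cvg_big => [|i _]; [exact: add_continuous|exact: fc]. Qed.

Lemma continuous_prod (K : numFieldType) I (r : seq I) (f : I -> T -> K) :
  (forall i, {for x, continuous (f i)}) ->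
  {for x, continuous (fun y => \prod_(i <- r) f i y)}.
Proof. by move=> fc; apply: cvg_big => [|i _]; [exact: mul_continuous|exact: fc]. Qed.

Lemma continuous_det (K : numFieldType) n (F : T -> 'M[K]_n) :
  {for x, continuous F} -> {for x, continuous (fun y => \det (F y))}.
Proof.
move=> Fc; apply: continuous_sum => s; apply: continuousM; first exact: cvg_cst.
by apply: continuous_prod => i; apply: continuous_entry.
Qed.

Lemma continuous_adj (K : numFieldType) n (F : T -> 'M[K]_n) :
  {for x, continuous F} -> {for x, continuous (fun y => \adj (F y))}.
Proof.
move=> Fc; apply: continuous_mx => i j.
rewrite (_ : (fun _ => _) = fun y => (-1) ^+ (j + i) * \det (row' j (col' i (F y)))).
  apply: continuousM; first exact: cvg_cst.
  apply: continuous_det; apply: continuous_mx => k l.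
  rewrite (_ : (fun _ => _) = fun y => F y (lift j k) (lift i l)).
    exact: continuous_entry.
  by apply/funext => y; rewrite !mxE.
by apply/funext => y; rewrite mxE.
Qed.

Lemma continuous_mulmx (K : numFieldType) m n p (F : T -> 'M[K]_(m, n))
    (G : T -> 'M[K]_(n, p)) :
  {for x, continuous F} -> {for x, continuous G} ->
  {for x, continuous (fun y => F y *m G y)}.
Proof.
move=> Fc Gc; apply: continuous_mx => i j.
rewrite (_ : (fun _ => _) = fun y => \sum_k F y i k * G y k j).
  by apply: continuous_sum => k; apply: continuousM; apply: continuous_entry.
by apply/funext => y; rewrite mxE.
Qed.

Lemma continuous_trmx (K : numFieldType) m n (F : T -> 'M[K]_(m, n)) :
  {for x, continuous F} -> {for x, continuous (fun y => (F y)^T)}.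
Proof.
move=> Fc; apply: continuous_mx => i j.
rewrite (_ : (fun _ => _) = fun y => F y j i); first exact: continuous_entry.
by apply/funext => y; rewrite mxE.
Qed.

Variable R : realType.

Lemma continuous_Re (f : T -> R[i]) :
  {for x, continuous f} -> {for x, continuous (fun y => complex.Re (f y))}.
Proof.
move=> fc; apply/cvgrPdist_lt => e e0.
have eC : 0 < e%:C%C by rewrite ltcR.
have near_f : \forall y \near x, `|f x - f y| < e%:C%C.
  exact: (cvgrPdist_lt _ _).1 fc _ eC.
apply: (filterS _ near_f) => y.
rewrite normc_def ltcR; apply: le_lt_trans.
rewrite -sqrtr_sqr ler_sqrt; last by rewrite addr_ge0 ?sqr_ge0.
by rewrite -raddfB lerDl sqr_ge0.
Qed.

Lemma continuous_Im (f : T -> R[i]) :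
  {for x, continuous f} -> {for x, continuous (fun y => complex.Im (f y))}.
Proof.
move=> fc; apply/cvgrPdist_lt => e e0.
have eC : 0 < e%:C%C by rewrite ltcR.
have near_f : \forall y \near x, `|f x - f y| < e%:C%C.
  exact: (cvgrPdist_lt _ _).1 fc _ eC.
apply: (filterS _ near_f) => y.
rewrite normc_def ltcR; apply: le_lt_trans.
rewrite -sqrtr_sqr ler_sqrt; last by rewrite addr_ge0 ?sqr_ge0.
by rewrite -raddfB lerDr sqr_ge0.
Qed.

Lemma continuous_real_complex (f : T -> R) :
  {for x, continuous f} -> {for x, continuous (fun y => (f y)%:C%C : R[i])}.
Proof.
move=> fc; apply/cvgrPdist_lt => e; rewrite ltcE => /andP[/eqP /= e0 e1].
have near_f : \forall y \near x, `|f x - f y| < complex.Re e.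
  exact: (cvgrPdist_lt _ _).1 fc _ e1.
apply: (filterS _ near_f) => y.
by rewrite -rmorphB/= normc_def /= expr0n addr0 sqrtr_sqr ltcE /= e0 eqxx.
Qed.

Lemma continuous_conjc (f : T -> R[i]) :
  {for x, continuous f} -> {for x, continuous (fun y => ((f y)^*)%C)}.
Proof.
move=> fc; apply/cvgrPdist_lt => e e0.
have near_f : \forall y \near x, `|f x - f y| < e.
  exact: (cvgrPdist_lt _ _).1 fc _ e0.
apply: (filterS _ near_f) => y; rewrite -rmorphB /=.
by case: (f x - f y) => a b; rewrite !normc_def /= sqrrN.
Qed.

Lemma continuous_normc (f : T -> R[i]) :
  {for x, continuous f} -> {for x, continuous (fun y => `|f y| : R[i])}.
Proof.
move=> fc; apply/cvgrPdist_lt => e e0.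
have near_f : \forall y \near x, `|f x - f y| < e.
  exact: (cvgrPdist_lt _ _).1 fc _ e0.
apply: (filterS _ near_f) => y.
by apply: le_lt_trans; apply: ler_dist_dist.
Qed.

End Continuity.

Lemma continuous_bigmax (T : topologicalType) (R : realType) (I : Type) (r : seq I)
    (f : I -> T -> R) (x : T) :
  (forall i, {for x, continuous (f i)}) ->
  {for x, continuous (fun y => \big[Num.max/0]_(i <- r) f i y)}.
Proof. by move=> fc; apply: cvg_big => [|i _]; [exact: max_continuous|exact: fc]. Qed.

Lemma continuous_steepness (R : realType) (T : topologicalType) (x : T) n
    (al be : T -> 'I_n -> R) :
  (forall i, {for x, continuous (al ^~ i)}) -> (forall i, {for x, continuous (be ^~ i)}) ->
  (forall i, al x i != 0) ->
  {for x, continuous (fun y => steepness (al y) (be y))}.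
Proof.
move=> alc bec al0; apply: continuous_bigmax => i.
apply: (@continuousM _ _ (be ^~ i) (fun y => (al y i)^-1)) => //.
exact: (@continuousV R _ (al ^~ i)).
Qed.

Section UnitContinuity.
Variables (R : realType) (T : topologicalType) (p : T) (l h t : T -> R).
Hypotheses (lc : {for p, continuous l}) (hc : {for p, continuous h}).
Hypothesis tc : {for p, continuous t}.

Let onec : {for p, continuous (fun=> 1 : R)}. Proof. exact: cvg_cst. Qed.

Lemma continuous_to_unit : 1 + t p * l p + (1 - t p * h p) != 0 ->
  {for p, continuous (fun y => to_unit (l y) (h y) (t y))}.
Proof.
move=> d0.
have c1 : {for p, continuous (fun y => 1 + t y * l y)}.
  exact: (continuousD onec (continuousM tc lc)).
have c2 : {for p, continuous (fun y => 1 - t y * h y)}.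
  exact: (continuousB onec (continuousM tc hc)).
have c3 : {for p, continuous (fun y => 1 + t y * l y + (1 - t y * h y))}.
  exact: (continuousD c1 c2).
exact: (continuousM c1 (@continuousV R T _ p d0 c3)).
Qed.

Lemma continuous_of_unit : l p * (1 - t p) + h p * t p != 0 ->
  {for p, continuous (fun y => of_unit (l y) (h y) (t y))}.
Proof.
move=> d0.
have c1 : {for p, continuous (fun y => 2 * t y - 1)}.
  have c2 : {for p, continuous (fun y => 2 * t y)}.
    exact: (@continuousM R T (fun=> 2) _ p (@cst_continuous _ _ _ _) tc).
  exact: (continuousB c2 onec).
have c2 : {for p, continuous (fun y => 1 - t y)} by exact: (continuousB onec tc).
have c3 : {for p, continuous (fun y => l y * (1 - t y) + h y * t y)}.
  exact: (continuousD (continuousM lc c2) (continuousM hc tc)).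
exact: (continuousM c1 (@continuousV R T _ p d0 c3)).
Qed.

End UnitContinuity.

(** * Planes, Pluecker coordinates and phases *)

Lemma det_mx2 (K : comNzRingType) (A : 'M[K]_2) : \det A = A 0 0 * A 1 1 - A 0 1 * A 1 0.
Proof.
rewrite (expand_det_row _ ord0) !big_ord_recl big_ord0 addr0 /cofactor !det_mx11.
rewrite !mxE /= expr0 expr1 mul1r mulN1r mulrN.
by congr (_ * A _ _ - A _ _ * A _ _); apply: val_inj.
Qed.

Lemma ord2P (j : 'I_2) : {j = 0} + {j = 1}.
Proof. by case: j => [[|[|]]] // p; [left|right]; apply: val_inj. Qed.

Section Planes.
Variable R : realType.
Local Notation C := R[i].

Definition plucker (B : 'M[C]_(2, 4)) (i j : 'I_4) : C :=
  B 0 i * B 1 j - B 0 j * B 1 i.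

(** This is the cross-ratio p01 p23 / (p02 p13) times the nonnegative real
    |p02 p13|^2; it avoids the quotient, and its imaginary part is a
    polynomial in the real and imaginary parts of the entries. *)
Definition cross (B : 'M[C]_(2, 4)) : C :=
  plucker B (inord 0) (inord 1) * plucker B (inord 2) (inord 3) *
  (plucker B (inord 0) (inord 2) * plucker B (inord 1) (inord 3))^*%C.

Lemma plucker_mul (G : 'M[C]_2) (B : 'M[C]_(2, 4)) i j :
  plucker (G *m B) i j = \det G * plucker B i j.
Proof.
rewrite /plucker !mxE !big_ord_recl !big_ord0 !addr0 det_mx2.
rewrite (_ : lift ord0 ord0 = 1); last exact: val_inj.
by ring.
Qed.

Definition cx m n (x : 'M[R]_(m, n)) : 'M[C]_(m, n) := map_mx (real_complex R) x.

Lemma cxE m n (x : 'M[R]_(m, n)) i j : cx x i j = (x i j)%:C%C.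
Proof. by rewrite mxE. Qed.

(** Multiplication by conj th_i turns the condition for the i-th coordinate to
    lie in R th_i into the vanishing of an imaginary part. *)
Definition rot (th : 'rV[C]_4) m (M : 'M[C]_(m, 4)) : 'M[C]_(m, 4) :=
  \matrix_(k, i) (M k i * (th 0 i)^*%C).

Definition im_rot th m (M : 'M[C]_(m, 4)) : 'M[R]_(m, 4) :=
  map_mx (@complex.Im R) (rot th M).
Definition re_rot th m (M : 'M[C]_(m, 4)) : 'M[R]_(m, 4) :=
  map_mx (@complex.Re R) (rot th M).

Lemma ImZ (r : R) (z : C) : complex.Im (r%:C%C * z) = r * complex.Im z.
Proof. by case: z => a b; rewrite /= mul0r addr0. Qed.
Lemma ReZ (r : R) (z : C) : complex.Re (r%:C%C * z) = r * complex.Re z.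
Proof. by case: z => a b; rewrite /= mul0r subr0. Qed.

Lemma im_rot_mul th m n (x : 'M[R]_(m, n)) (M : 'M[C]_(n, 4)) :
  im_rot th (cx x *m M) = x *m im_rot th M.
Proof.
apply/matrixP => k i; rewrite !mxE mulr_suml raddf_sum; apply: eq_bigr => j _.
by rewrite !mxE -mulrA; exact: ImZ.
Qed.

Lemma re_rot_mul th m n (x : 'M[R]_(m, n)) (M : 'M[C]_(n, 4)) :
  re_rot th (cx x *m M) = x *m re_rot th M.
Proof.
apply/matrixP => k i; rewrite !mxE mulr_suml raddf_sum; apply: eq_bigr => j _.
by rewrite !mxE -mulrA; exact: ReZ.
Qed.

Lemma im_rotD th m (M N : 'M[C]_(m, 4)) :
  im_rot th (M + N) = im_rot th M + im_rot th N.
Proof. by apply/matrixP => k i; rewrite !mxE mulrDl raddfD. Qed.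

Lemma re_rotD th m (M N : 'M[C]_(m, 4)) :
  re_rot th (M + N) = re_rot th M + re_rot th N.
Proof. by apply/matrixP => k i; rewrite !mxE mulrDl raddfD. Qed.

(** The rows of B and their multiples by i span over R the complex row space
    of B. *)
Definition real_basis (B : 'M[C]_(2, 4)) : 'M[C]_(2 + 2, 4) :=
  col_mx B ('i%C *: B).

Definition of_real (x : 'rV[R]_(2 + 2)) : 'rV[C]_2 :=
  cx (lsubmx x) + 'i%C *: cx (rsubmx x).
Definition to_real (c : 'rV[C]_2) : 'rV[R]_(2 + 2) :=
  row_mx (map_mx (@complex.Re R) c) (map_mx (@complex.Im R) c).

Lemma to_realK : cancel to_real of_real.
Proof.
move=> c; rewrite /of_real /to_real row_mxKl row_mxKr.
by apply/rowP => j; rewrite !mxE -complexE.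
Qed.

Lemma of_realK : cancel of_real to_real.
Proof.
move=> x; rewrite /of_real /to_real -[RHS]hsubmxK.
by congr row_mx; apply/rowP => j; rewrite !mxE; simpc.
Qed.

Lemma of_real_mul x (B : 'M[C]_(2, 4)) : of_real x *m B = cx x *m real_basis B.
Proof.
rewrite -{2}(hsubmxK x) /cx map_row_mx mul_row_col mulmxDl.
by rewrite -scalemxAl scalemxAr.
Qed.

Lemma im_real (z : C) : complex.Im z = 0 -> z = (complex.Re z)%:C%C.
Proof. by case: z => a b /= ->. Qed.

(** If c and d are independent over C, the minors of the two vectors c B and
    d B are the minors of B up to the determinant of (c, d), and they become real after
    multiplication by conj th_i conj th_j; the product of four of them that
    enters [cross] makes [cross B] real.  Otherwise d = l c, and l is the
    quotient of two real numbers at a coordinate where c B does not vanish. *)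
Lemma kernel_line (B : 'M[C]_(2, 4)) (th : 'rV[C]_4) (c d : 'rV[C]_2) :
    complex.Im (cross B) != 0 -> \rank B = 2%N -> (forall i, th 0 i != 0) ->
    im_rot th (c *m B) = 0 -> im_rot th (d *m B) = 0 -> c != 0 ->
  exists t : R, d = t%:C%C *: c.
Proof.
move=> crossB rkB th0 cK dK c0.
have realc i : (c *m B) 0 i * (th 0 i)^*%C =
    (complex.Re ((c *m B) 0 i * (th 0 i)^*%C))%:C%C.
  by apply: im_real; have /rowP /(_ i) := cK; rewrite !mxE.
have reald i : (d *m B) 0 i * (th 0 i)^*%C =
    (complex.Re ((d *m B) 0 i * (th 0 i)^*%C))%:C%C.
  by apply: im_real; have /rowP /(_ i) := dK; rewrite !mxE.
have thJ i : (th 0 i)^*%C != 0 by rewrite conjc_eq0.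
pose G : 'M[C]_2 := \matrix_(k, j) if k == 0 then c 0 j else d 0 j.
have G0 i : (G *m B) 0 i = (c *m B) 0 i.
  by rewrite !mxE; apply: eq_bigr => j _; rewrite mxE.
have G1 i : (G *m B) 1 i = (d *m B) 0 i.
  by rewrite !mxE; apply: eq_bigr => j _; rewrite mxE.
have minor i j : exists r : R,
    \det G * plucker B i j * ((th 0 i)^*%C * (th 0 j)^*%C) = r%:C%C.
  rewrite -plucker_mul /plucker !G0 !G1.
  exists (complex.Re ((c *m B) 0 i * (th 0 i)^*%C) *
          complex.Re ((d *m B) 0 j * (th 0 j)^*%C) -
          complex.Re ((c *m B) 0 j * (th 0 j)^*%C) *
          complex.Re ((d *m B) 0 i * (th 0 i)^*%C)).
  by rewrite rmorphB !rmorphM /= -!realc -!reald; ring.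
have detG : \det G = 0.
  apply/eqP; apply: contraNT crossB => D0.
  set i0 : 'I_4 := inord 0; set i1 : 'I_4 := inord 1.
  set i2 : 'I_4 := inord 2; set i3 : 'I_4 := inord 3.
  have [r01 e01] := minor i0 i1; have [r23 e23] := minor i2 i3.
  have [r02 e02] := minor i0 i2; have [r13 e13] := minor i1 i3.
  (* {0,1}, {2,3} and {0,2}, {1,3} both exhaust the indices, so the two products
   of minors differ from those of B by the same factor w. *)
  pose w := \det G ^+ 2 * ((th 0 i0)^*%C * (th 0 i1)^*%C * (th 0 i2)^*%C * (th 0 i3)^*%C).
  have w0 : w != 0 by rewrite !mulf_neq0 ?expf_neq0.
  have : (`|w| ^+ 2) * cross B = (r01 * r23 * (r02 * r13))%:C%C.
    rewrite 3!rmorphM /= -e01 -e23.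
    rewrite -(conjc_real r02) -(conjc_real r13) -e02 -e13.
    rewrite sqr_normc /cross -/i0 -/i1 -/i2 -/i3 /w !(rmorphM, rmorphXn) /=.
    by ring.
  rewrite -add_Re2_Im2 => /(congr1 (@complex.Im R)); rewrite ImZ /= => /eqP.
  rewrite mulf_eq0 => /orP[|//].
  by rewrite -(inj_eq (@complexI R)) add_Re2_Im2 expf_eq0 /= normr_eq0 (negPf w0).
have [l dl] : exists l : C, d = l *: c.
  have det0 : c 0 0 * d 0 1 = c 0 1 * d 0 0.
    by apply/eqP; rewrite -subr_eq0 -detG det_mx2 !mxE.
  have [c00|c00] := eqVneq (c 0 0) 0.
    have c01 : c 0 1 != 0.
      apply: contraNneq c0 => c01; apply/eqP/rowP => j; rewrite mxE.
      by case: (ord2P j) => ->.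
    exists (d 0 1 / c 0 1); apply/rowP => j; rewrite mxE.
    move/esym/eqP: det0; rewrite c00 mul0r mulf_eq0 (negPf c01) => /eqP d00.
    by case: (ord2P j) => ->; rewrite ?divfK// d00 c00 mulr0.
  exists (d 0 0 / c 0 0); apply/rowP => j; rewrite mxE.
  case: (ord2P j) => ->; rewrite ?divfK//.
  by apply: (mulfI c00); rewrite det0; field.
have cB0 : c *m B != 0.
  have Bfree : row_free B by rewrite /row_free rkB.
  by rewrite mulmx_free_eq0.
have [i ci] : exists i, (c *m B) 0 i != 0.
  apply/existsP; apply: contraNT cB0; rewrite negb_exists => /forallP ci.
  by apply/eqP/rowP => i; rewrite [RHS]mxE; have := ci i; rewrite negbK => /eqP.
exists (complex.Re l); rewrite -im_real//.
have := reald i; have := realc i.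
set s := complex.Re _; set s' := complex.Re _ => es.
rewrite dl -scalemxAl mxE -mulrA es => /(congr1 (@complex.Im R)) /=.
case: (l) => a b /=; rewrite mulr0 add0r => /eqP; rewrite mulf_eq0 => /orP[/eqP//|/eqP s0].
by move: es; rewrite s0 => /eqP; rewrite mulf_eq0 (negPf ci) (negPf (thJ i)).
Qed.
End Planes.

Lemma im_rotE (R : realType) (th : 'rV[R[i]]_4) m (M : 'M[R[i]]_(m, 4)) k i :
  im_rot th M k i = complex.Im (M k i * (th 0 i)^*%C).
Proof. by rewrite !mxE. Qed.

Lemma re_rotE (R : realType) (th : 'rV[R[i]]_4) m (M : 'M[R[i]]_(m, 4)) k i :
  re_rot th M k i = complex.Re (M k i * (th 0 i)^*%C).
Proof. by rewrite !mxE. Qed.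

(** * The critical points of the coamoeba map *)

Lemma ArgE (R : realType) (z : 'rV[R[i]]_4) i j : Arg z i j = z 0 j / `|z 0 j|.
Proof. by rewrite mxE. Qed.

Section Differentials.
Variable R : realType.

Lemma is_diff_coord n (w : 'rV[R]_n) a :
  is_diff w (fun y : 'rV[R]_n => y 0 a) (fun v => v 0 a).
Proof.
pose f (N : 'rV[R]_n) := N 0 a.
have flin : linear f by move=> k u v; rewrite /f !mxE.
pose fM := GRing.isLinear.Build _ _ _ _ _ flin.
pose fL : {linear 'rV[R]_n -> R} := HB.pack f fM.
have fc : continuous fL by exact: coord_continuous.
apply: DiffDef; first exact: (linear_differentiable w fc).
exact: (diff_lin w fc).
Qed.

Lemma is_diff_row (V : normedModType R) n (F : V -> 'rV[R]_n) (df : 'I_n -> V -> R) (x : V) :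
  (forall k, is_diff x (fun y => F y 0 k) (df k)) ->
  is_diff x F (fun v => \row_k df k v).
Proof.
move=> dF.
have Fd : differentiable F x.
  have -> : F = \sum_(k < n) (fun y => F y 0 k *: delta_mx 0 k).
    apply/funext => y; rewrite fct_sumE; exact: row_sum_delta.
  by apply: differentiable_sum => k; apply: differentiableZl; apply: ex_diff.
apply: DiffDef => //; apply/funext => v; apply/rowP => k; rewrite mxE.
have := dF k; have := is_diff_coord (F x) k => dc dk.
have := @diff_comp _ _ _ _ F (fun y : 'rV[R]_n => y 0 k) x Fd (@ex_diff _ _ _ _ _ _ _ dc).
move/(congr1 (fun g => g v)) => /=.
by rewrite (@diff_val _ _ _ _ _ _ _ dc) => <-; rewrite (@diff_val _ _ _ _ _ _ _ dk).
Qed.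

Lemma is_diff_sqrt (r : R) : 0 < r ->
  is_diff r Num.sqrt (fun h => h * (2 * Num.sqrt r)^-1).
Proof.
move=> r0; have [dr er] := is_derive1_sqrt r0.
apply: DiffDef; first exact/derivable1_diffP.
by rewrite deriv1E// derive1E er.
Qed.

(** For z = f + i g this is the real part of d(z/|z|) = i z Im (conj z dz) /
    |z|^3; exchanging f and g gives the imaginary part. *)
Lemma is_diff_normalized (V : normedModType R) (f g df dg : V -> R) (x : V)
    (s := Num.sqrt (f x ^+ 2 + g x ^+ 2)) :
  is_diff x f df -> is_diff x g dg -> 0 < f x ^+ 2 + g x ^+ 2 ->
  is_diff x (fun y => f y / Num.sqrt (f y ^+ 2 + g y ^+ 2))
    (fun v => g x * (g x * df v - f x * dg v) / s ^+ 3).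
Proof.
move=> dF dG N0; have s0 : s != 0 by rewrite gt_eqF ?sqrtr_gt0.
have dN : is_diff x (f ^+ 2 + g ^+ 2) (2%:R * f x ^+ 1 *: df + 2%:R * g x ^+ 1 *: dg).
  by apply: is_diffD.
have NE : (f ^+ 2 + g ^+ 2) x = f x ^+ 2 + g x ^+ 2 by rewrite /= !expr2.
have dS : is_diff x (Num.sqrt \o (f ^+ 2 + g ^+ 2)) ((fun h => h * (2 * s)^-1) \o
    (2%:R * f x ^+ 1 *: df + 2%:R * g x ^+ 1 *: dg)).
  apply: is_diff_comp; rewrite NE; exact: is_diff_sqrt.
have Sx : (Num.sqrt \o (f ^+ 2 + g ^+ 2)) x = s by rewrite /= /s -NE.
have Sx0 : (Num.sqrt \o (f ^+ 2 + g ^+ 2)) x != 0 by rewrite Sx.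
have dI : is_diff x (fun y => ((Num.sqrt \o (f ^+ 2 + g ^+ 2)) y)^-1)
    (fun v => - s ^- 2 * ((2%:R * f x * df v + 2%:R * g x * dg v) * (2 * s)^-1)).
  apply: DiffDef; first by apply: differentiableV => //; exact: ex_diff.
  rewrite diffV//.
  by rewrite Sx diff_val; apply/funext => v.
have := is_diffM dF dI.
have -> : f * (fun y => ((Num.sqrt \o (f ^+ 2 + g ^+ 2)) y)^-1) =
    fun y => f y / Num.sqrt (f y ^+ 2 + g y ^+ 2).
  by apply/funext => y /=; rewrite /= !expr2.
set D := (X in is_diff_def _ _ X) => dP.
suff <- : D = (fun v => g x * (g x * df v - f x * dg v) / s ^+ 3) by [].
apply/funext => v; rewrite /D.
have s2 : s ^+ 2 = f x ^+ 2 + g x ^+ 2 by rewrite sqr_sqrtr// ltW.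
apply: (mulIf (expf_neq0 3 s0)); rewrite divfK ?expf_neq0//.
transitivity (s ^+ 2 * df v - f x * (f x * df v + g x * dg v)).
  change ((f x * (- s ^- 2 * ((2%:R * f x * df v + 2%:R * g x * dg v) * (2 * s)^-1))
    + ((Num.sqrt \o (f ^+ 2 + g ^+ 2)) x)^-1 * df v) * s ^+ 3
    = s ^+ 2 * df v - f x * (f x * df v + g x * dg v)).
  rewrite Sx.
  by field.
by rewrite s2; ring.
Qed.

End Differentials.

Section Critical.
Variable R : realType.
Local Notation C := R[i].

(** The modulus as an element of R rather than of C. *)
Definition len (z : C) : R := Num.sqrt (complex.Re z ^+ 2 + complex.Im z ^+ 2).

Lemma lenE (z : C) : `|z| = (len z)%:C%C.
Proof. exact: normc_def. Qed.

Lemma len_gt0 (z : C) : z != 0 -> 0 < len z.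
Proof. by rewrite -normr_gt0 lenE ltcR. Qed.

Lemma Arg_mulJ (z : 'rV[C]_4) i : z 0 i != 0 -> Arg z 0 i * (Arg z 0 i)^*%C = 1.
Proof.
move=> zi; rewrite -sqr_normc ArgE normrM normfV normr_id divff ?expr1n//.
by rewrite normr_eq0.
Qed.

Lemma ArgJ (z : 'rV[C]_4) i : (Arg z 0 i)^*%C = ((len (z 0 i))^-1)%:C%C * (z 0 i)^*%C.
Proof.
by rewrite ArgE lenE -fmorphV rmorphM /= oppr0 mulrC.
Qed.

Lemma Re_div_len (z : C) : complex.Re (z / `|z|) = complex.Re z / len z.
Proof. by rewrite lenE -fmorphV mulrC ReZ mulrC. Qed.

Lemma Im_div_len (z : C) : complex.Im (z / `|z|) = complex.Im z / len z.
Proof. by rewrite lenE -fmorphV mulrC ImZ mulrC. Qed.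

Lemma realifyE (z : 'rV[C]_4) (i : 'I_4) :
  (realify z 0 (lshift 4 i) = complex.Re (z 0 i)) *
  (realify z 0 (rshift 4 i) = complex.Im (z 0 i)).
Proof. by rewrite /realify row_mxEl row_mxEr !mxE. Qed.

Lemma complexifyE (x : 'rV[R]_(4 + 4)) i :
  complexify x 0 i = (x 0 (lshift 4 i) +i* x 0 (rshift 4 i))%C.
Proof. by rewrite !mxE. Qed.

(** Arg only sees the rotational part of v, which is Im (v_i / z_i). *)
Lemma real_diff_Arg (z v : 'rV[C]_4) i : (forall i, z 0 i != 0) ->
  real_diff (@Arg R) z v 0 i =
    'i%C * Arg z 0 i * (im_rot (Arg z) v 0 i / len (z 0 i))%:C%C.
Proof.
move=> z0; pose F : 'rV[R]_(4 + 4) -> 'rV[R]_(4 + 4) := @realify R \o @Arg R \o @complexify R.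
pose x := realify z.
pose N (w : 'rV[R]_(4 + 4)) (i : 'I_4) := w 0 (lshift 4 i) ^+ 2 + w 0 (rshift 4 i) ^+ 2.
have Fl w j : F w 0 (lshift 4 j) = w 0 (lshift 4 j) / Num.sqrt (N w j).
  by rewrite /F /= realifyE ArgE Re_div_len complexifyE.
have Fr w j : F w 0 (rshift 4 j) =
    w 0 (rshift 4 j) / Num.sqrt (w 0 (rshift 4 j) ^+ 2 + w 0 (lshift 4 j) ^+ 2).
  by rewrite /F /= realifyE ArgE Im_div_len complexifyE /len /= addrC.
have xl j : x 0 (lshift 4 j) = complex.Re (z 0 j) by rewrite realifyE.
have xr j : x 0 (rshift 4 j) = complex.Im (z 0 j) by rewrite realifyE.
have N0 j : 0 < N x j.
  by rewrite -sqrtr_gt0 /N xl xr; apply: len_gt0.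
pose D (a b : 'I_(4 + 4)) (h : 'rV[R]_(4 + 4)) : R :=
  x 0 b * (x 0 b * h 0 a - x 0 a * h 0 b) / Num.sqrt (x 0 a ^+ 2 + x 0 b ^+ 2) ^+ 3.
pose dF k (h : 'rV[R]_(4 + 4)) : R :=
  match fintype.split k with
  | inl j => D (lshift 4 j) (rshift 4 j) h
  | inr j => D (rshift 4 j) (lshift 4 j) h
  end.
have Fdiff : is_diff x F (fun h => \row_k dF k h).
  apply: is_diff_row => k; rewrite /dF; case: split_ordP => j ->.
    have -> : (fun y => F y 0 (lshift 4 j)) = fun y => y 0 (lshift 4 j) /
        Num.sqrt (y 0 (lshift 4 j) ^+ 2 + y 0 (rshift 4 j) ^+ 2).
      by apply/funext => w; exact: Fl.
    have := N0 j; apply: (is_diff_normalized (f := fun y : 'rV[R]_(4 + 4) => y 0 (lshift 4 j))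
      (g := fun y : 'rV[R]_(4 + 4) => y 0 (rshift 4 j))); exact: is_diff_coord.
  have -> : (fun y => F y 0 (rshift 4 j)) = fun y => y 0 (rshift 4 j) /
      Num.sqrt (y 0 (rshift 4 j) ^+ 2 + y 0 (lshift 4 j) ^+ 2).
    by apply/funext => w; exact: Fr.
  have := N0 j; rewrite /N addrC.
  apply: (is_diff_normalized (f := fun y : 'rV[R]_(4 + 4) => y 0 (rshift 4 j))
    (g := fun y : 'rV[R]_(4 + 4) => y 0 (lshift 4 j))); exact: is_diff_coord.
rewrite /real_diff complexifyE (@diff_val _ _ _ _ _ _ _ Fdiff).
rewrite ![(\row_k _) 0 _]mxE /dF (unsplitK (inl i)) (unsplitK (inr i)).
rewrite /D !xl !xr !realifyE (addrC (complex.Im (z 0 i) ^+ 2)) -!/(len _).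
have -> : im_rot (Arg z) v 0 i =
    (len (z 0 i))^-1 * complex.Im (v 0 i * (z 0 i)^*%C).
  by rewrite mxE mxE ArgJ mulrCA ImZ.
have s0 := lt0r_neq0 (len_gt0 (z0 i)).
rewrite lenE -fmorphV; set s := len (z 0 i) in s0 *.
case: (z 0 i) => p q; case: (v 0 i) => dp dq; simpc.
apply/eqP; rewrite eq_complex /=; apply/andP; split; apply/eqP; field; exact: s0.
Qed.

Lemma tangent_planeE (a : 'rV[C]_4) B z : affine_plane a B z ->
  tangent_plane (affine_plane a B) z = [set c *m B | c in [set: 'rV[C]_2]].
Proof.
move=> [c0 _ <-]; apply/seteqP; split => [_ [_ [c _ <-] <-]|_ [c _ <-]].
  by exists (c - c0) => //; rewrite mulmxBl [a + c *m B]addrC addrKA.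
exists (a + (c + c0) *m B); first by exists (c + c0).
by rewrite mulmxDl addrC opprD addrACA; rewrite addNr add0r addrC addrK.
Qed.

(** Both tangent spaces have real dimension 4, and in the bases given by
    [real_basis B] and by i theta_i the differential of the coamoeba map is the
    matrix [im_rot (Arg z) (real_basis B)] up to positive factors 1 / |z_i|. *)
Lemma criticalP (a : 'rV[C]_4) B z :
  critical_points (affine_plane a B) z <->
  in_torus (affine_plane a B) z /\ \det (im_rot (Arg z) (real_basis B)) = 0.
Proof.
split=> -[Vz cz]; split=> //; have [Vz' z0] := Vz.
  apply/eqP; apply/negP => /negP det0; apply: cz => w wT.
  have Au : im_rot (Arg z) (real_basis B) \in unitmx by rewrite unitmxE unitfE.
  (* The factor |z_i| compensates the 1 / |z_i| of the differential. *)
  pose y : 'rV[R]_4 := \row_i (im_rot (Arg z) w 0 i * len (z 0 i)).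
  pose c := of_real (y *m invmx (im_rot (Arg z) (real_basis B))).
  exists (c *m B); first by rewrite tangent_planeE//; exists c.
  apply/rowP => i; rewrite real_diff_Arg//.
  rewrite /c of_real_mul im_rot_mul mulmxKV// [y 0 i]mxE.
  rewrite mulfK ?lt0r_neq0 ?len_gt0//.
  have -> : ('i * Arg z 0 i * (im_rot (Arg z) w 0 i)%:C)%C =
      Arg z 0 i * (w 0 i * (Arg z 0 i)^*%C).
    rewrite -mulrA mulrCA; congr (_ * _).
    rewrite [RHS]complexE wT add0r; congr (_ * _%:C%C).
    by rewrite mxE mxE.
  by rewrite mulrCA Arg_mulJ// mulr1.
move=> sub; move/eqP: cz; rewrite -det_tr => /det0P[u u0 uA].
have [k uk] : exists k, u 0 k != 0.
  apply/existsP; apply: contraNT u0; rewrite negb_exists => /forallP u0.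
  by apply/eqP/rowP => i; rewrite [RHS]mxE; have := u0 i; rewrite negbK => /eqP.
(* u is a linear relation between the columns of the matrix with u_k != 0, so
   the k-th basis vector of the tangent space of the torus is not reached. *)
pose w : 'rV[C]_4 := \row_i ('i%C * Arg z 0 i * ((i == k)%:R)%:C%C).
have wT : tangent_torus (Arg z) w.
  move=> i; rewrite mxE mulrAC -[_ * _ * (Arg z 0 i)^*%C]mulrA Arg_mulJ// mulr1 mulrC ReZ /=.
  by rewrite mulr0.
have [v Vv vw] := sub _ wT.
move: Vv; rewrite tangent_planeE// => -[c _ cv].
have /(congr1 (fun M => (M *m u^T) 0 0)) : im_rot (Arg z) v = \row_i ((i == k)%:R * len (z 0 i)).
  apply/rowP => i; rewrite [RHS]mxE.
  have /(congr1 (fun M : 'rV[C]_4 => M 0 i)) := vw.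
  rewrite real_diff_Arg// [w 0 i]mxE => /(mulfI _) H.
  have nz : 'i%C * Arg z 0 i != 0.
    apply: mulf_neq0; first by rewrite eq_complex /= oner_eq0 andbF.
    by apply/eqP => A0; have /eqP := Arg_mulJ (z0 i); rewrite A0 mul0r eq_sym oner_eq0.
  by have /complexI <- := H nz; rewrite divfK// gt_eqF// len_gt0.
rewrite -cv -[c]to_realK of_real_mul im_rot_mul -mulmxA.
have -> : im_rot (Arg z) (real_basis B) *m u^T = 0.
  by apply: trmx_inj; rewrite trmx_mul trmxK uA trmx0.
rewrite mulmx0 mxE mxE (bigD1 k)//= big1 => [|i ik].
  rewrite !mxE eqxx mul1r addr0 => /esym/eqP.
  by rewrite mulf_eq0 (negPf uk) (gt_eqF (len_gt0 (z0 k))).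
by rewrite mxE (negPf ik) !mul0r.
Qed.
End Critical.

(** z / |z| = th means that z conj th is a positive real number. *)
Lemma Arg_eqP (R : realType) (th z : 'rV[R[i]]_4) :
  (forall i, th 0 i * (th 0 i)^*%C = 1) ->
  (forall i, z 0 i != 0) /\ Arg z = th <->
  im_rot th z = 0 /\ forall i, 0 < re_rot th z 0 i.
Proof.
move=> unit_th; split=> [[z0 <-]|[im0 re0]].
  have zJ i : z 0 i * (Arg z 0 i)^*%C = (len (z 0 i))%:C%C.
    rewrite -lenE -{1}[z 0 i](@divfK _ `|z 0 i|) ?normr_eq0//.
    by rewrite -(ArgE z 0) mulrAC Arg_mulJ// mul1r.
  split=> [|i]; last by rewrite re_rotE zJ /= len_gt0.
  by apply/rowP => i; rewrite im_rotE zJ mxE.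
have zJ i : z 0 i * (th 0 i)^*%C = (re_rot th z 0 i)%:C%C.
  rewrite re_rotE -im_real//.
  by have /rowP/(_ i) := im0; rewrite im_rotE [RHS]mxE.
have zE i : z 0 i = (re_rot th z 0 i)%:C%C * th 0 i.
  by rewrite -zJ mulrAC -mulrA unit_th mulr1.
have norm_th i : `|th 0 i| = 1.
  by apply/eqP; rewrite -sqrp_eq1 ?normr_ge0// sqr_normc unit_th.
have normz i : `|z 0 i| = (re_rot th z 0 i)%:C%C.
  by rewrite zE normrM norm_th mulr1 ger0_norm// ler0c ltW.
have z0 i : z 0 i != 0 by rewrite -normr_eq0 normz gt_eqF// ltcR.
split=> //; apply/rowP => i; rewrite ArgE normz {1}zE mulrAC divff ?mul1r//.
by rewrite -normz normr_eq0.
Qed.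

Lemma continuous_Arg (R : realType) (z : 'rV[R[i]]_4) :
  (forall i, z 0 i != 0) -> {for z, continuous (@Arg R)}.
Proof.
move=> z0; apply: continuous_mx => i j.
have cj : {for z, continuous (fun y : 'rV[R[i]]_4 => y 0 j)}.
  exact: coord_continuous.
have cn := continuous_normc cj.
have cv : {for z, continuous (fun y : 'rV[R[i]]_4 => `|y 0 j|^-1)}.
  by apply: (@continuousV R[i]) => //; rewrite normr_eq0.
have cm := @continuousM R[i] _ _ _ z cj cv.
have E : (fun y => Arg y i j) = (fun y : 'rV[R[i]]_4 => y 0 j / `|y 0 j|).
  by apply/funext => y; rewrite ArgE.
rewrite E.
exact: cm.
Qed.

Section ContinuityPhase.
Variables (R : realType) (T : topologicalType) (x : T) (th : T -> 'rV[R[i]]_4).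
Hypothesis thc : {for x, continuous th}.

Lemma continuous_rot_entry m (M : 'M[R[i]]_(m, 4)) k i :
  {for x, continuous (fun y => M k i * (th y 0 i)^*%C)}.
Proof.
have cth := continuous_conjc (@continuous_entry T x R[i] _ _ th 0 i thc).
exact: (@continuousM R[i] _ (fun=> M k i) _ x (@cst_continuous _ _ _ _) cth).
Qed.

Lemma continuous_im_rot m (M : 'M[R[i]]_(m, 4)) :
  {for x, continuous (fun y => im_rot (th y) M)}.
Proof.
apply: continuous_mx => k i.
have c := continuous_Im (@continuous_rot_entry m M k i).
suff -> : (fun y => im_rot (th y) M k i) =
  (fun y => complex.Im (M k i * (th y 0 i)^*%C)) by exact: c.
by apply/funext => y; rewrite ?im_rotE ?re_rotE.
Qed.

Lemma continuous_re_rot m (M : 'M[R[i]]_(m, 4)) :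
  {for x, continuous (fun y => re_rot (th y) M)}.
Proof.
apply: continuous_mx => k i.
have c := continuous_Re (@continuous_rot_entry m M k i).
suff -> : (fun y => re_rot (th y) M k i) =
  (fun y => complex.Re (M k i * (th y 0 i)^*%C)) by exact: c.
by apply/funext => y; rewrite ?im_rotE ?re_rotE.
Qed.
End ContinuityPhase.

(** * Linear systems with a one-dimensional kernel *)

Lemma row_dot_eq0 (R : realType) n (u : 'rV[R]_n) : u *m u^T = 0 -> u = 0.
Proof.
move/matrixP => /(_ 0 0); rewrite !mxE => s0; apply/rowP => j; rewrite mxE.
have sq i : 0 <= u 0 i * u^T i 0 by rewrite mxE -expr2 sqr_ge0.
have : u 0 j * u^T j 0 = 0.
  apply/eqP; move/eqP: s0; rewrite psumr_eq0 => [|i _]; last exact: sq.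
  by move/allP => /(_ j); rewrite mem_index_enum => /(_ isT).
by rewrite mxE => /eqP; rewrite mulf_eq0 orbb => /eqP.
Qed.

Section Bordering.
Variables (R : realType) (n m : nat).
Variables (A : 'M[R]_(n, m)) (k0 : 'rV[R]_n).

(** The Gram matrix of the rows of A bordered by the column k0^T, that is, the
    matrix of the normal equations of the system formed by x A = y and
    x . k0 = s. *)
Definition bordered : 'M[R]_n := A *m A^T + k0^T *m k0.

(** u P u^T = |u A|^2 + (u . k0)^2 for the bordered matrix P. *)
Lemma bordered_unit :
  (forall u : 'rV[R]_n, u *m A = 0 -> u *m k0^T = 0 -> u = 0) -> \det bordered != 0.
Proof.
move=> inj; apply/det0P => -[u u0 uP]; move/eqP: u0; apply.
have : (u *m A) *m (u *m A)^T + (u *m k0^T) *m (u *m k0^T)^T = 0.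
  have /(congr1 (fun M => M *m u^T)) := uP.
  by rewrite mul0mx /bordered mulmxDr mulmxDl !trmx_mul trmxK !mulmxA.
have sq p (w : 'rV[R]_p) : 0 <= (w *m w^T) 0 0.
  by rewrite mxE sumr_ge0// => i _; rewrite mxE -expr2 sqr_ge0.
move/matrixP => /(_ 0 0); rewrite [LHS]mxE [RHS]mxE => /eqP.
rewrite paddr_eq0 ?sq// => /andP[/eqP e1 /eqP e2].
by apply: inj; apply: row_dot_eq0; apply/matrixP => i j; rewrite !ord1 [RHS]mxE.
Qed.

(** Cramer's formula rather than invmx: no case analysis on invertibility, so
    continuity is inherited from the determinant and the adjugate. *)
Definition bordered_inv : 'M[R]_n := (\det bordered)^-1 *: \adj bordered.

Lemma bordered_mulV : \det bordered != 0 -> bordered *m bordered_inv = 1%:M.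
Proof.
by move=> d0; rewrite -scalemxAr mul_mx_adj scale_scalar_mx mulVf.
Qed.

(** When the bordered matrix is invertible, the only candidate for a solution of
    k A = 0, k . k0 = 1. *)
Definition kernel_vector : 'rV[R]_n := k0 *m bordered_inv.

(** When the bordered matrix is invertible, the only candidate for a solution of
    b + x A = 0, x . k0 = s. *)
Definition solution (b : 'rV[R]_m) (s : R) : 'rV[R]_n :=
  (s *: k0 - b *m A^T) *m bordered_inv.

(** The parameter t shifts the prescribed value of x . k0: solutions for two
    different values differ by a multiple of the kernel vector. *)
Lemma solution_unique b (x : 'rV[R]_n) t : \det bordered != 0 -> b + x *m A = 0 ->
  x = solution b ((x *m k0^T) 0 0 - t) + t *: kernel_vector.
Proof.
move=> d0 /eqP; rewrite addrC addr_eq0 => /eqP xA.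
rewrite /solution /kernel_vector scalemxAl -mulmxDl.
rewrite -[LHS]mulmx1 -(bordered_mulV d0) mulmxA; congr (_ *m _).
rewrite /bordered mulmxDr !mulmxA xA mulNmx [in LHS](mx11_scalar (x *m k0^T)).
by rewrite mul_scalar_mx addrC scalerBl addrAC subrK.
Qed.

(** The formula for [kernel_vector] makes sense whenever the bordered matrix is
    invertible, but it produces a kernel vector only if there is a nonzero one;
    a given kernel vector k1 is then a multiple of it. *)
Lemma kernel_vectorP (k1 : 'rV[R]_n) : \det bordered != 0 -> k1 != 0 -> k1 *m A = 0 ->
  kernel_vector *m A = 0 /\ kernel_vector *m k0^T = 1%:M.
Proof.
move=> d0 k10 k1A; pose t := (k1 *m k0^T) 0 0.
have k1E : k1 = t *: kernel_vector.
  have := @solution_unique 0 k1 t d0; rewrite add0r => /(_ k1A).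
  by rewrite /solution subrr scale0r mul0mx subr0 mul0mx add0r.
have t0 : t != 0 by apply: contraNneq k10 => t0; rewrite k1E t0 scale0r.
have kE : kernel_vector = t^-1 *: k1 by rewrite k1E scalerA mulVf// scale1r.
rewrite kE -!scalemxAl k1A scaler0; split=> //.
by rewrite (mx11_scalar (k1 *m k0^T)) -/t scale_scalar_mx mulVf.
Qed.

(** Likewise, [solution] solves the system only if the system is solvable; then
    it is obtained from a given solution x1 by moving along the kernel. *)
Lemma solutionP b s (x1 k1 : 'rV[R]_n) : \det bordered != 0 -> k1 != 0 -> k1 *m A = 0 ->
  b + x1 *m A = 0 ->
  b + solution b s *m A = 0 /\ solution b s *m k0^T = s%:M.
Proof.
move=> d0 k10 k1A x1A; have [kA kk] := kernel_vectorP d0 k10 k1A.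
have := solution_unique ((x1 *m k0^T) 0 0 - s) d0 x1A; rewrite subKr.
set t := _ - s => x1E.
have -> : solution b s = x1 - t *: kernel_vector by rewrite [in RHS]x1E addrK.
rewrite !mulmxBl -!scalemxAl kA kk scaler0 subr0 x1A; split=> //.
rewrite (mx11_scalar (x1 *m k0^T)) scale_scalar_mx mulr1 -raddfB /t.
by rewrite subKr.
Qed.

End Bordering.

Section ContinuityBordered.
Variables (R : realType) (T : topologicalType) (x : T) (n m : nat).
Variables (A : T -> 'M[R]_(n, m)) (k0 : 'rV[R]_n) (b : T -> 'rV[R]_m).
Hypothesis Ac : {for x, continuous A}.
Hypothesis bc : {for x, continuous b}.

Lemma continuous_bordered : {for x, continuous (fun y => bordered (A y) k0)}.
Proof.
exact: (continuousD (continuous_mulmx Ac (continuous_trmx Ac)) (@cst_continuous _ _ _ _)).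
Qed.

Hypothesis d0 : \det (bordered (A x) k0) != 0.

Lemma continuous_bordered_inv : {for x, continuous (fun y => bordered_inv (A y) k0)}.
Proof.
have cd := continuous_det continuous_bordered.
have cV := @continuousV R T (fun y => \det (bordered (A y) k0)) x d0 cd.
exact: (continuousZ cV (continuous_adj continuous_bordered)).
Qed.

Lemma continuous_kernel_vector : {for x, continuous (fun y => kernel_vector (A y) k0)}.
Proof.
exact: (@continuous_mulmx _ _ _ _ _ _ (fun=> k0) _ (@cst_continuous _ _ _ _)
  continuous_bordered_inv).
Qed.

Lemma continuous_solution s : {for x, continuous (fun y => solution (A y) k0 (b y) s)}.
Proof.
have cb := continuous_mulmx bc (continuous_trmx Ac).
have cn : {for x, continuous (fun y => s *: k0 - b y *m (A y)^T)}.
  exact: (@continuousB _ _ _ (fun=> s *: k0) _ x (@cst_continuous _ _ _ _) cb).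
exact: (continuous_mulmx cn continuous_bordered_inv).
Qed.

End ContinuityBordered.

(** * Charts of the set of critical points *)

Section Plane.
Variables (R : realType) (a : 'rV[R[i]]_4) (B : 'M[R[i]]_(2, 4)).
Hypothesis rkB : \rank B = 2%N.
Implicit Types (th z : 'rV[R[i]]_4) (x k : 'rV[R]_(2 + 2)).

Definition point x : 'rV[R[i]]_4 := a + of_real x *m B.
Definition coord z : 'rV[R]_(2 + 2) := to_real ((z - a) *m pinvmx B).
Definition im_mx th : 'M[R]_(2 + 2, 4) := im_rot th (real_basis B).
Definition re_mx th : 'M[R]_(2 + 2, 4) := re_rot th (real_basis B).

Lemma coordK x : coord (point x) = x.
Proof.
rewrite /coord /point addrC addKr mulmxKp ?of_realK//.
by rewrite /row_free rkB.
Qed.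

Lemma im_point th x : im_rot th (point x) = im_rot th a + x *m im_mx th.
Proof. by rewrite im_rotD of_real_mul im_rot_mul. Qed.

Lemma re_point th x : re_rot th (point x) = re_rot th a + x *m re_mx th.
Proof. by rewrite re_rotD of_real_mul re_rot_mul. Qed.

Lemma point_coord z : affine_plane a B z -> point (coord z) = z.
Proof. by move=> [c _ <-]; rewrite -[c]to_realK -/(point _) coordK. Qed.

(** Singularity of the matrix depends on th only, so a fibre consists of
    critical points as soon as it contains one. *)
Lemma critical_fibre th x : (forall i, th 0 i * (th 0 i)^*%C = 1) ->
  critical_points (affine_plane a B) (point x) /\ Arg (point x) = th <->
  [/\ \det (im_mx th) = 0, im_rot th a + x *m im_mx th = 0 &
      forall i, 0 < (re_rot th a + x *m re_mx th) 0 i].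
Proof.
move=> uth; have Vx : affine_plane a B (point x) by exists (of_real x).
rewrite criticalP -im_point -re_point; split.
  move=> [[[_ z0] det0] Argx]; have [im0 re0] := (Arg_eqP _ uth).1 (conj z0 Argx).
  by split=> //; rewrite -Argx.
move=> [det0 im0 re0]; have [z0 Argx] := (Arg_eqP _ uth).2 (conj im0 re0).
by rewrite Argx.
Qed.

Lemma critical_Arg z : critical_points (affine_plane a B) z ->
  [/\ forall i, z 0 i != 0, forall i, Arg z 0 i * (Arg z 0 i)^*%C = 1 &
      point (coord z) = z].
Proof.
move=> [[Vz z0] _]; split=> // [i|]; first exact: Arg_mulJ.
exact: point_coord.
Qed.

Hypothesis crossB : complex.Im (cross B) != 0.

Lemma im_mx_kernel th x y : (forall i, th 0 i != 0) ->
  x *m im_mx th = 0 -> y *m im_mx th = 0 -> x != 0 -> exists t, y = t *: x.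
Proof.
move=> th0 xK yK x0.
have [|||t /(congr1 (@to_real R))] := @kernel_line R B th (of_real x) (of_real y) crossB rkB th0.
- by rewrite of_real_mul im_rot_mul.
- by rewrite of_real_mul im_rot_mul.
- apply: contraNneq x0 => /(congr1 (@to_real R)); rewrite of_realK => ->.
  by apply/eqP/rowP => j; rewrite /to_real !mxE; case: fintype.splitP => l _; rewrite !mxE.
rewrite of_realK => ->; exists t; rewrite -[in RHS](of_realK x) /to_real scale_row_mx.
by congr row_mx; apply/rowP => j; rewrite !mxE ?ReZ ?ImZ.
Qed.

Lemma re_mx_kernel th x : (forall i, th 0 i * (th 0 i)^*%C = 1) ->
  x *m im_mx th = 0 -> x *m re_mx th = 0 -> x = 0.
Proof.
move=> uth xim xre.
suff : of_real x *m B = 0.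
  move/eqP; rewrite mulmx_free_eq0 ?/row_free ?rkB// => /eqP x0.
  have xE := coordK x; rewrite /coord /point x0 mul0mx addr0 subrr mul0mx in xE.
  rewrite -xE; apply/rowP => j.
  by rewrite /to_real !mxE; case: fintype.splitP => l _; rewrite !mxE.
rewrite of_real_mul; apply/rowP => i; rewrite [RHS]mxE.
have : (cx x *m real_basis B) 0 i * (th 0 i)^*%C = 0.
  apply/eqP; rewrite eq_complex -re_rotE -im_rotE re_rot_mul im_rot_mul.
  by rewrite -/(im_mx _) -/(re_mx _) xim xre !mxE !eqxx.
move/eqP; rewrite mulf_eq0 => /orP[/eqP//|/eqP thJ].
by have /eqP := uth i; rewrite thJ mulr0 eq_sym oner_eq0.
Qed.

Section Chart.
Variables (x0 k0 : 'rV[R]_(2 + 2)).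

Let s0 : R := (x0 *m k0^T) 0 0.
Definition base_solution th := solution (im_mx th) k0 (im_rot th a) s0.
Definition direction th := kernel_vector (im_mx th) k0.
Definition offset th i := (re_rot th a + base_solution th *m re_mx th) 0 i.
Definition slope th i := (direction th *m re_mx th) 0 i.
Definition inv_left th := steepness (offset th) (slope th).
Definition inv_right th := steepness (offset th) (fun i => - slope th i).

(** On this set the bordered matrix is invertible and the continuous base point
    still lies in the open orthant. *)
Definition chart_domain : set 'rV[R[i]]_4 :=
  [set th | \det (bordered (im_mx th) k0) != 0 /\ forall i, 0 < offset th i].

(** k0^T reads off the position along the fibre, since the direction is
    normalized by direction . k0 = 1. *)
Definition height z : R :=
  to_unit (inv_left (Arg z)) (inv_right (Arg z)) ((coord z *m k0^T) 0 0 - s0).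
Definition chart (p : 'rV[R[i]]_4 * R) : 'rV[R[i]]_4 :=
  point (base_solution p.1 + of_unit (inv_left p.1) (inv_right p.1) p.2 *: direction p.1).

Let Z := critical_points (affine_plane a B).

(** Over a critical value in the chart domain the fibre is an open interval of
    the line through [base_solution th] with direction [direction th], and that
    interval is not the whole line. *)
Lemma fibre_line th : (@Arg R @` Z) th -> chart_domain th ->
  [/\ forall t, (base_solution th + t *: direction th) *m k0^T = (s0 + t)%:M,
      forall x, im_rot th a + x *m im_mx th = 0 ->
        x = base_solution th + ((x *m k0^T) 0 0 - s0) *: direction th,
      0 < inv_left th + inv_right th &
      forall t, Z (point (base_solution th + t *: direction th)) /\
                Arg (point (base_solution th + t *: direction th)) = th <->
                0 < 1 + t * inv_left th /\ 0 < 1 - t * inv_right th].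
Proof.
move=> [z Zz zth] [d0 al0].
have [z0 uz zE] := critical_Arg Zz; rewrite zth in uz.
have [det0 sol _] : [/\ \det (im_mx th) = 0, im_rot th a + coord z *m im_mx th = 0 &
      forall i, 0 < (re_rot th a + coord z *m re_mx th) 0 i].
  by apply/critical_fibre; rewrite ?zE.
have /eqP/det0P[k1 k10 k1A] := det0.
have [dirA dirk] := kernel_vectorP d0 k10 k1A.
have [secA seck] := solutionP s0 d0 k10 k1A sol.
have line t : im_rot th a + (base_solution th + t *: direction th) *m im_mx th = 0.
  by rewrite mulmxDl -scalemxAl dirA scaler0 addr0.
have alE t i : (re_rot th a + (base_solution th + t *: direction th) *m re_mx th) 0 i =
    offset th i + t * slope th i.
  rewrite /offset /slope mulmxDl -scalemxAl addrA [LHS]mxE.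
  by congr (_ + _); rewrite [LHS]mxE.
split.
- move=> t; rewrite mulmxDl -scalemxAl seck dirk.
  by rewrite scale_scalar_mx mulr1 -raddfD.
- move=> x xA; rewrite [LHS](solution_unique ((x *m k0^T) 0 0 - s0) d0 xA).
  by rewrite subKr.
- apply: steepness_gt0 => //; apply/existsP; rewrite -[X in is_true X]negbK negb_exists.
  apply/negP => /forallP be0.
  have dir0 : direction th = 0.
    apply: re_mx_kernel uz dirA _; apply/rowP => i; rewrite [RHS]mxE.
    by have := be0 i; rewrite negbK => /eqP.
  move: dirk; rewrite -/(direction th) dir0 mul0mx => /matrixP/(_ 0 0).
  by rewrite !mxE => /eqP; rewrite eq_sym oner_eq0.
- move=> t; rewrite critical_fibre// -line_positive//; split.
    by move=> [_ _ pos] i; rewrite -alE.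
  by move=> pos; split=> // i; rewrite alE.
Qed.

End Chart.
End Plane.

Section PlaneContinuity.
Variables (R : realType) (a : 'rV[R[i]]_4) (B : 'M[R[i]]_(2, 4)).
Variables (T : topologicalType) (p : T).

Lemma continuous_point (x : T -> 'rV[R]_(2 + 2)) :
  {for p, continuous x} -> {for p, continuous (fun y => point a B (x y))}.
Proof.
move=> xc.
have cc : {for p, continuous (fun y => cx (x y))}.
  apply: continuous_mx => i j.
  have c := continuous_real_complex (@continuous_entry T p R _ _ x i j xc).
  suff -> : (fun y => cx (x y) i j) = (fun y => (x y i j)%:C%C) by exact: c.
  by apply/funext => y; rewrite cxE.
have cm := @continuous_mulmx T p R[i] _ _ _ (fun y => cx (x y))
   (fun=> real_basis B) cc (@cst_continuous _ _ _ _).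
have cD := @continuousD _ _ _ (fun=> a) _ p (@cst_continuous _ _ _ _) cm.
suff -> : (fun y => point a B (x y)) = (fun=> a) + (fun y => cx (x y) *m real_basis B).
  exact: cD.
by apply/funext => y; rewrite /point of_real_mul.
Qed.

Lemma continuous_coord (z : T -> 'rV[R[i]]_4) :
  {for p, continuous z} -> {for p, continuous (fun y => coord a B (z y))}.
Proof.
move=> zc.
have cB : {for p, continuous (fun y => z y - a)}.
  exact: (@continuousB _ _ _ z (fun=> a) p zc (@cst_continuous _ _ _ _)).
have cm := @continuous_mulmx T p R[i] _ _ _ (fun y => z y - a)
   (fun=> pinvmx B) cB (@cst_continuous _ _ _ _).
apply: continuous_mx => i j; rewrite ord1 /coord /to_real.
case: (split_ordP j) => l ->.
  have c := continuous_Re (@continuous_entry T p R[i] _ _ _ 0 l cm).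
  suff -> : (fun y => row_mx (map_mx (@complex.Re R) ((z y - a) *m pinvmx B))
      (map_mx (@complex.Im R) ((z y - a) *m pinvmx B)) 0 (lshift 2 l)) =
    (fun y => complex.Re (((z y - a) *m pinvmx B) 0 l)) by exact: c.
  by apply/funext => y; rewrite row_mxEl [LHS]mxE.
have c := continuous_Im (@continuous_entry T p R[i] _ _ _ 0 l cm).
suff -> : (fun y => row_mx (map_mx (@complex.Re R) ((z y - a) *m pinvmx B))
    (map_mx (@complex.Im R) ((z y - a) *m pinvmx B)) 0 (rshift 2 l)) =
  (fun y => complex.Im (((z y - a) *m pinvmx B) 0 l)) by exact: c.
by apply/funext => y; rewrite row_mxEr [LHS]mxE.
Qed.

Variables (x0 k0 : 'rV[R]_(2 + 2)) (th : T -> 'rV[R[i]]_4).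
Hypothesis thc : {for p, continuous th}.
Hypothesis d0 : \det (bordered (im_mx B (th p)) k0) != 0.

Let im_mxc : {for p, continuous (fun y => im_mx B (th y))}.
Proof. exact: (@continuous_im_rot R T p th thc _ (real_basis B)). Qed.

Lemma continuous_base_solution : {for p, continuous (fun y => base_solution a B x0 k0 (th y))}.
Proof.
have ac := @continuous_im_rot R T p th thc _ a.
exact: (continuous_solution im_mxc ac d0).
Qed.

Lemma continuous_direction : {for p, continuous (fun y => direction B k0 (th y))}.
Proof.
exact: (continuous_kernel_vector im_mxc d0).
Qed.

Lemma continuous_offset i : {for p, continuous (fun y => offset a B x0 k0 (th y) i)}.
Proof.
have cm := continuous_mulmx continuous_base_solution
  (@continuous_re_rot R T p th thc _ (real_basis B)).
have cD := continuousD (@continuous_re_rot R T p th thc _ a) cm.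
exact: (@continuous_entry T p R _ _ _ 0 i cD).
Qed.

Lemma continuous_slope i : {for p, continuous (fun y => slope B k0 (th y) i)}.
Proof.
have cm := continuous_mulmx continuous_direction
  (@continuous_re_rot R T p th thc _ (real_basis B)).
exact: (@continuous_entry T p R _ _ _ 0 i cm).
Qed.

Hypothesis al0 : forall i, 0 < offset a B x0 k0 (th p) i.

Lemma continuous_inv_left : {for p, continuous (fun y => inv_left a B x0 k0 (th y))}.
Proof.
apply: continuous_steepness => [i|i|i]; [exact: continuous_offset|exact: continuous_slope|].
by rewrite gt_eqF.
Qed.

Lemma continuous_inv_right : {for p, continuous (fun y => inv_right a B x0 k0 (th y))}.
Proof.
apply: continuous_steepness => [i|i|i]; [exact: continuous_offset| |by rewrite gt_eqF].
exact: (continuousN (@continuous_slope i)).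
Qed.

End PlaneContinuity.

Section PlaneBundle.
Variables (R : realType) (a : 'rV[R[i]]_4) (B : 'M[R[i]]_(2, 4)).
Hypotheses (rkB : \rank B = 2%N) (crossB : complex.Im (cross B) != 0).
Let Z := critical_points (affine_plane a B).

(** At the centre of the chart the bordered matrix is invertible because k0
    spans the kernel, and the base point is the chosen point of the fibre. *)
Lemma chart_domain_nbhs (z0 : 'rV[R[i]]_4) (k0 : 'rV[R]_(2 + 2)) :
    Z z0 -> k0 != 0 -> k0 *m im_mx B (Arg z0) = 0 ->
  nbhs (Arg z0) (chart_domain a B (coord a B z0) k0).
Proof.
move=> Zz k00 k0A; have [znz uz zE] := critical_Arg rkB Zz.
set th0 := Arg z0 in k0A uz *; set x0 := coord a B z0.
have thnz i : th0 0 i != 0.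
  by apply/eqP => t0; have /eqP := uz i; rewrite t0 mul0r eq_sym oner_eq0.
have [_ sol pos] : [/\ \det (im_mx B th0) = 0, im_rot th0 a + x0 *m im_mx B th0 = 0 &
      forall i, 0 < (re_rot th0 a + x0 *m re_mx B th0) 0 i].
  by apply/critical_fibre; rewrite ?zE.
have d0 : \det (bordered (im_mx B th0) k0) != 0.
  apply: bordered_unit => u uA uk.
  have [t ut] := im_mx_kernel rkB crossB thnz k0A uA k00.
  apply: row_dot_eq0; rewrite [in X in X *m _]ut -scalemxAl.
  by rewrite -[k0 in LHS]trmxK -trmx_mul uk trmx0 scaler0.
have al0 i : 0 < offset a B x0 k0 th0 i.
  have := solution_unique 0 d0 sol; rewrite subr0 scale0r addr0 => x0E.
  by rewrite /offset /base_solution -x0E.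
have idc : {for th0, continuous (fun th : 'rV[R[i]]_4 => th)} by exact: cvg_id.
have dc : {for th0, continuous (fun th => \det (bordered (im_mx B th) k0))}.
  have imc := @continuous_im_rot R _ th0 _ idc _ (real_basis B).
  exact: (continuous_det (@continuous_bordered R _ th0 _ _ _ k0 imc)).
have alc i := @continuous_offset R a B _ th0 x0 k0 _ idc d0 i.
apply: filterI.
  have : nbhs (\det (bordered (im_mx B th0) k0)) [set r : R | r != 0].
    by apply: open_nbhs_nbhs; split=> //; exact: open_neq.
  exact: dc.
have near_al i : nbhs th0 [set th | 0 < offset a B x0 k0 th i].
  exact: (cvgr_gt _ (alc i) _ (al0 i)).
exact: (@filter_forall _ _ (fun i th => 0 < offset a B x0 k0 th i) _ _ near_al).
Qed.

Theorem affine_plane_bundle :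
  locally_trivial_bundle (`]0, 1[%classic : set R) (restr (@Arg R) (A := Z)).
Proof.
apply: locally_trivial_restr => [z Zz|y0 [z0 Zz0 <-]].
  by have [znz _ _] := critical_Arg rkB Zz; exact: continuous_Arg.
have [_ /eqP/det0P[k0 k00 k0A]] := (criticalP a B z0).1 Zz0.
set x0 := coord a B z0.
exists (chart_domain a B x0 k0), (height a B x0 k0), (chart a B x0 k0).
have lo0 th : 0 <= inv_left a B x0 k0 th by exact: steepness_ge0.
have hi0 th : 0 <= inv_right a B x0 k0 th by exact: steepness_ge0.
split; first exact: chart_domain_nbhs.
- move=> z Zz Wz; have [znz uz zE] := critical_Arg rkB Zz.
  have [hk coordE lohi fib] := fibre_line rkB (ex_intro2 _ _ z Zz erefl) Wz.
  have [_ sol _] : [/\ \det (im_mx B (Arg z)) = 0,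
      im_rot (Arg z) a + coord a B z *m im_mx B (Arg z) = 0 &
      forall i, 0 < (re_rot (Arg z) a + coord a B z *m re_mx B (Arg z)) 0 i].
    by apply/critical_fibre; rewrite ?zE.
  have xE := coordE _ sol.
  have [tlo thi] :
      0 < 1 + ((coord a B z *m k0^T) 0 0 - (x0 *m k0^T) 0 0) * inv_left a B x0 k0 (Arg z) /\
      0 < 1 - ((coord a B z *m k0^T) 0 0 - (x0 *m k0^T) 0 0) * inv_right a B x0 k0 (Arg z).
    by apply/fib; rewrite -xE zE.
  split.
  + by rewrite /= in_itv /=; exact: to_unit_itv.
  + by rewrite /chart /= to_unitK// -xE zE.
  + have argc := continuous_Arg znz.
    have idc : {for z, continuous (fun y : 'rV[R[i]]_4 => y)} by exact: cvg_id.
    have cc := @continuous_entry _ z R _ _ _ 0 0 (continuous_mulmx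
      (continuous_coord (a := a) (B := B) idc) (@cst_continuous _ _ (k0^T) z)).
    have tc := continuousB cc (@cst_continuous _ _ ((x0 *m k0^T) 0 0) z).
    have [d0 al0] := Wz.
    have lc := @continuous_inv_left R a B _ z x0 k0 _ argc d0 al0.
    have hc := @continuous_inv_right R a B _ z x0 k0 _ argc d0 al0.
    apply: (continuous_to_unit lc hc tc).
    by rewrite gt_eqF// addr_gt0.
- move=> y u Zy Wy u01.
  have {}u01 : 0 < u < 1 by move: u01; rewrite /= in_itv.
  have [hk coordE lohi fib] := fibre_line rkB Zy Wy.
  have [tlo thi uE] := of_unit_bounds (lo0 y) (hi0 y) lohi u01.
  have [Zg gy] := (fib _).2 (conj tlo thi).
  split=> //.
  + rewrite /height -[Arg _]/(Arg (point a B _)) /chart /= gy coordK//.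
    by rewrite hk mxE eqxx mulr1n addrC addKr.
  + have [d0 al0] := Wy.
    have fc : {for (y, u), continuous (fun p : 'rV[R[i]]_4 * R => p.1)} by exact: cvg_fst.
    have sc : {for (y, u), continuous (fun p : 'rV[R[i]]_4 * R => p.2)} by exact: cvg_snd.
    have lc := @continuous_inv_left R a B _ (y, u) x0 k0 _ fc d0 al0.
    have hc := @continuous_inv_right R a B _ (y, u) x0 k0 _ fc d0 al0.
    have bc := @continuous_base_solution R a B _ (y, u) x0 k0 _ fc d0.
    have dc := @continuous_direction R B _ (y, u) k0 _ fc d0.
    have den := lt0r_neq0 (of_unit_den (lo0 y) (hi0 y) lohi u01).
    have tc := @continuous_of_unit R _ (y, u) _ _ _ lc hc sc den.
    exact: (continuous_point (continuousD bc (continuousZ tc dc))).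
Qed.

End PlaneBundle.

(** * Genericity *)

Section Genericity.
Variable R : realType.
Local Notation C := R[i].

Lemma cross_mul (G : 'M[C]_2) (B : 'M[C]_(2, 4)) :
  cross (G *m B) = `|\det G ^+ 2| ^+ 2 * cross B.
Proof. by rewrite /cross !plucker_mul sqr_normc !(rmorphM, rmorphXn) /=; ring. Qed.

(** The rows of B are differences of points of the plane. *)
Lemma affine_plane_dir (a a' : 'rV[C]_4) (B B' : 'M[C]_(2, 4)) :
  affine_plane a B = affine_plane a' B' -> exists G, B = G *m B'.
Proof.
move=> VE.
have [c0 _ c0E] : affine_plane a' B' a by rewrite -VE; exists 0 => //; rewrite mul0mx addr0.
suff /choice[f fE] : forall i : 'I_2, exists c : 'rV[C]_2, row i B = c *m B'.
  exists (\matrix_i f i); apply/row_matrixP => i.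
  by rewrite row_mul rowK fE.
move=> i; have [c _ cE] : affine_plane a' B' (a + row i B).
  by rewrite -VE; exists (delta_mx 0 i) => //; rewrite -rowE.
exists (c - c0); rewrite mulmxBl; apply: (@addrI _ a).
by rewrite -cE -c0E addrACA subrr addr0.
Qed.

Lemma Im_cross_plane (a a' : 'rV[C]_4) (B B' : 'M[C]_(2, 4)) :
  affine_plane a B = affine_plane a' B' ->
  complex.Im (cross B') = 0 -> complex.Im (cross B) = 0.
Proof.
move=> /affine_plane_dir[G ->] c0.
by rewrite cross_mul -add_Re2_Im2 ImZ c0 mulr0.
Qed.

(** Functions of B given by a real polynomial in the real coordinates of
    (a, B); closure under ring operations replaces writing out the polynomial
    for [cross]. *)
Definition polynomial_fun (f : 'M[C]_(2, 4) -> R) : Prop :=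
  exists p : mpoly ((1 + 2) * (4 + 4)) R, forall (a : 'rV[C]_4) B,
    meval (fun k => real_coords (col_mx a B) 0 k) p = f B.

Lemma polynomial_funD f g : polynomial_fun f -> polynomial_fun g ->
  polynomial_fun (fun B => f B + g B).
Proof. by move=> [p pE] [q qE]; exists (p + q) => a B; rewrite mevalD pE qE. Qed.

Lemma polynomial_funN f : polynomial_fun f -> polynomial_fun (fun B => - f B).
Proof. by move=> [p pE]; exists (- p) => a B; rewrite mevalN pE. Qed.

Lemma polynomial_funM f g : polynomial_fun f -> polynomial_fun g ->
  polynomial_fun (fun B => f B * g B).
Proof. by move=> [p pE] [q qE]; exists (p * q) => a B; rewrite mevalM pE qE. Qed.

Definition complex_polynomial_fun (f : 'M[C]_(2, 4) -> C) : Prop :=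
  polynomial_fun (fun B => complex.Re (f B)) /\
  polynomial_fun (fun B => complex.Im (f B)).

Lemma polynomial_fun_ext f g : f =1 g -> polynomial_fun f -> polynomial_fun g.
Proof. by move=> /funext ->. Qed.

Lemma complex_polynomial_entry i j : complex_polynomial_fun (fun B => B i j).
Proof.
split.
  exists (mpolyX R (mnm1 (mxvec_index (rshift 1 i) (lshift 4 j)))) => a B.
  by rewrite mevalXU /real_coords mxvecE row_mxEl mxE col_mxEd.
exists (mpolyX R (mnm1 (mxvec_index (rshift 1 i) (rshift 4 j)))) => a B.
by rewrite mevalXU /real_coords mxvecE row_mxEr mxE col_mxEd.
Qed.

Lemma complex_polynomialB f g :
  complex_polynomial_fun f -> complex_polynomial_fun g ->
  complex_polynomial_fun (fun B => f B - g B).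
Proof.
move=> [fr fi] [gr gi]; split.
  apply: polynomial_fun_ext (polynomial_funD fr (polynomial_funN gr)) => B /=.
  by case: (f B) (g B) => x y [].
apply: polynomial_fun_ext (polynomial_funD fi (polynomial_funN gi)) => B /=.
by case: (f B) (g B) => x y [].
Qed.

Lemma complex_polynomialM f g :
  complex_polynomial_fun f -> complex_polynomial_fun g ->
  complex_polynomial_fun (fun B => f B * g B).
Proof.
move=> [fr fi] [gr gi]; split.
  apply: polynomial_fun_ext (polynomial_funD (polynomial_funM fr gr)
    (polynomial_funN (polynomial_funM fi gi))) => B /=.
  by case: (f B) (g B) => x y [].
apply: polynomial_fun_ext (polynomial_funD (polynomial_funM fr gi)
  (polynomial_funM fi gr)) => B /=.
by case: (f B) (g B) => x y [].
Qed.

Lemma complex_polynomial_conj f : complex_polynomial_fun f ->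
  complex_polynomial_fun (fun B => (f B)^*%C).
Proof.
move=> [fr fi]; split.
  by apply: polynomial_fun_ext fr => B /=; case: (f B).
by apply: polynomial_fun_ext (polynomial_funN fi) => B /=; case: (f B).
Qed.

Lemma polynomial_cross : polynomial_fun (fun B => complex.Im (cross B)).
Proof.
have pl i j : complex_polynomial_fun (fun B => plucker B i j).
  by apply: complex_polynomialB; apply: complex_polynomialM;
     apply: complex_polynomial_entry.
have [] // := complex_polynomialM
  (complex_polynomialM (pl (inord 0) (inord 1)) (pl (inord 2) (inord 3)))
  (complex_polynomial_conj
    (complex_polynomialM (pl (inord 0) (inord 2)) (pl (inord 1) (inord 3)))).
Qed.

(** The exceptional planes.  The cross-ratio of the direction is invariant
    under change of basis, so the choice of (a, B) is immaterial. *)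
Definition real_cross_ratio (V : set 'rV[C]_4) : Prop :=
  exists a B, [/\ \rank B = 2%N, V = affine_plane a B & complex.Im (cross B) = 0].

Lemma real_cross_ratioE a B : \rank B = 2%N ->
  real_cross_ratio (affine_plane a B) <-> complex.Im (cross B) = 0.
Proof.
move=> rkB; split=> [[a' [B' [_ VE c0]]]|c0]; first exact: Im_cross_plane VE c0.
by exists a, B.
Qed.

Lemma real_cross_ratio_algebraic : real_algebraic real_cross_ratio.
Proof.
have [p pE] := polynomial_cross; exists [:: p] => a B rkB.
rewrite real_cross_ratioE// -(pE a); split=> [p0 q|]; last by apply; rewrite mem_head.
by rewrite inE => /eqP ->.
Qed.

(** A direction with cross-ratio 1 - i. *)
Definition sample_dir : 'M[C]_(2, 4) :=
  \matrix_(i, j) (if i == 0 then nth 0 [:: 1; 0; 1; 1] j else nth 0 [:: 0; 1; 1; 'i%C] j).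

Lemma cross_sample_dir : complex.Im (cross sample_dir) != 0.
Proof.
by rewrite /cross /plucker !mxE !inordK//= ?oppr_eq0 ?oner_eq0.
Qed.

Lemma rank_Im_cross_neq0 (B : 'M[C]_(2, 4)) :
  complex.Im (cross B) != 0 -> \rank B = 2%N.
Proof.
move=> ImB; have : cross B != 0 by apply: contraNneq ImB => ->.
rewrite /cross !mulf_eq0 !negb_or => /andP[/andP[p01 _] _].
suff /eqP : row_free B by [].
apply: inj_row_free => v vB.
have vBj j : v 0 0 * B 0 j + v 0 1 * B 1 j = 0.
  have /rowP/(_ j) := vB; rewrite !mxE !big_ord_recl big_ord0 addr0 => <-.
  by rewrite (_ : lift ord0 ord0 = 1)//; apply: val_inj.
set i := inord 0 in p01; set j := inord 1 in p01.
apply/rowP => k; rewrite mxE; apply: (mulIf p01); rewrite mul0r /plucker.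
case: (ord2P k) => ->.
  transitivity ((v 0 0 * B 0 i + v 0 1 * B 1 i) * B 1 j -
                (v 0 0 * B 0 j + v 0 1 * B 1 j) * B 1 i); first by ring.
  by rewrite !vBj !mul0r subrr.
transitivity ((v 0 0 * B 0 j + v 0 1 * B 1 j) * B 0 i -
              (v 0 0 * B 0 i + v 0 1 * B 1 i) * B 0 j); first by ring.
by rewrite !vBj !mul0r subrr.
Qed.

End Genericity.

Theorem theorem3 (R : realType) :
  generic_plane (fun V : set 'rV[R[i]]_4 =>
    let Z := critical_points V in
    let CZ := @Arg R @` Z in
    locally_trivial_bundle (`]0, 1[%classic : set R)
      (restr (@Arg R) (A := Z) : Z -> CZ)).
Proof.
exists (@real_cross_ratio R); split.
- exact: real_cross_ratio_algebraic.
- have rk := rank_Im_cross_neq0 (cross_sample_dir R).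
  exists (affine_plane 0 (sample_dir R)); first by exists 0, (sample_dir R).
  by rewrite real_cross_ratioE//; apply/eqP; exact: cross_sample_dir.
- move=> V [a [B [rkB ->]]] VE.
  by apply: affine_plane_bundle => //; apply/eqP => /(real_cross_ratioE a rkB).
Qed.
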